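(* Suppose $f\in W_0^{1,1}(\mathbb R)$. Then for every $\lambda>0$, $$|Tf(\lambda)|\le\frac{2\sqrt6}{\sqrt\pi}\,\|f'\|_1\,\lambda^{-1/2}.$$
   Context: The chirp transform of $f\in L^1(\mathbb R)$ is $Tf(\lambda)=\int_{\mathbb R}f(x)e^{-\pi i\lambda x^2}\,dx$, $\lambda\in\mathbb R$. $f\in W_0^{1,1}(\mathbb R)$ means that $\lim_{|x|\to\infty}f(x)=0$ and both $f$ and its weak derivative $f'$ belong to $L^1(\mathbb R)$. *)

(* Defs.v *)
From mathcomp Require Import all_boot all_order all_algebra.
From mathcomp Require Import complex.
From mathcomp Require Import all_classical all_reals all_analysis.

Set Implicit Arguments.
Unset Strict Implicit.
Unset Printing Implicit Defensive.

Import Order.TTheory GRing.Theory Num.Theory.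
Import numFieldNormedType.Exports.

Local Open Scope classical_set_scope.
Local Open Scope ring_scope.
Local Open Scope complex_scope.

(* The real-valued modulus; [`|z|] has type [R[i]]. *)
Notation cmod := ComplexField.Normc.normc.

(* MathComp-Analysis only integrates (extended) real-valued functions, so
   measurability and integrability over the real line of a complex-valued
   function are those of its real and imaginary parts. *)
Definition L1_integrable (R : realType) (f : R -> R[i]) : Prop :=
  lebesgue_measure.-integrable [set: R] (fun x => (complex.Re (f x))%:E) /\
  lebesgue_measure.-integrable [set: R] (fun x => (complex.Im (f x))%:E).

Definition L1_loc (R : realType) (f : R -> R[i]) : Prop :=
  locally_integrable [set: R] (fun x => complex.Re (f x)) /\
  locally_integrable [set: R] (fun x => complex.Im (f x)).

Definition Cintegral (R : realType) (f : R -> R[i]) : R[i] :=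
  (\int[lebesgue_measure]_x complex.Re (f x)) +i*
  (\int[lebesgue_measure]_x complex.Im (f x)).

(* Extended-real-valued: on measurable functions, it is finite exactly on L^1. *)
Definition L1_norm (R : realType) (f : R -> R[i]) : \bar R :=
  Lnorm (@lebesgue_measure R) 1%E (fun x => (cmod (f x))%:E).

(* e^{i t} for real t. *)
Definition expi (R : realType) (t : R) : R[i] := cos t +i* sin t.

Definition chirp (R : realType) (f : R -> R[i]) (lambda : R) : R[i] :=
  Cintegral (fun x => f x * expi (- (pi * lambda * x ^+ 2))).

(* Testing against real-valued or complex-valued functions defines the same
   weak derivative, by linearity. *)
Definition test_function (R : realType) (phi : R -> R) : Prop :=
  (forall (n : nat) (x : R), derivable (derive1n n phi) x 1) /\
  compact (closure [set x | phi x != 0]).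

Definition weak_derivative (R : realType) (f f' : R -> R[i]) : Prop :=
  [/\ L1_loc f, L1_loc f' &
    forall phi : R -> R, test_function phi ->
      Cintegral (fun x => f x * (derive1 phi x)%:C) =
      - Cintegral (fun x => f' x * (phi x)%:C)].

(* The two limits state f(x) --> 0 as |x| --> oo; they are stated on the modulus
   because R[i] carries no topology here. *)
Definition W011 (R : realType) (f : R -> R[i]) : Prop :=
  [/\ cmod (f x) @[x --> +oo] --> (0 : R),
      cmod (f x) @[x --> -oo] --> (0 : R),
      L1_integrable f &
      exists f' : R -> R[i], weak_derivative f f' /\ L1_integrable f'].

(* Main.v *)
Require Import Defs.
From mathcomp Require Import all_boot all_order all_algebra.
From mathcomp Require Import complex.
From mathcomp Require Import all_classical all_reals all_analysis.
From mathcomp Require Import measurable_realfun.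
From mathcomp Require Import ring lra.
Import Order.TTheory GRing.Theory Num.Theory.
Import numFieldNormedType.Exports.
Local Open Scope ring_scope.
Local Open Scope classical_set_scope.

(* Take K1, K2 vanishing at 0 with derivatives cos(c x^2), sin(c x^2), where
   c = pi lambda. Testing the weak derivative against K_j times a smooth cutoff
   dilated to infinity shows |int u K_j'| <= sup|K_j| int |u'| for u the real or
   imaginary part of f. A first-derivative estimate gives |K_j| <= 2 / sqrt c,
   so the chirp transform is at most 4 / sqrt(pi lambda) ||f'||_1, and
   2 <= sqrt 6. If ||f'||_1 is infinite there is nothing to prove, so the given
   f' may be assumed integrable. *)

(** * Calculus of functions differentiable to a given order *)

Section smoothness.
Context {R : realType}.
Implicit Types f g : R -> R.

(** Peeling off one derivative at a time suits induction on the order with the function left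
    general; smoothness is [forall n, nderivable n f]. *)
Fixpoint nderivable n f : Prop :=
  if n is m.+1 then
    (forall x : R, derivable f x 1) /\ nderivable m (derive1 f)
  else True.

Lemma derive1_funE f g :
  (forall x : R, is_derive x (1 : R) f (g x)) -> derive1 f = g.
Proof. by move=> fg; apply/funext => x; rewrite derive1E derive_val. Qed.

(** Trades [derive1 f] for an explicit formula of the derivative, to which the closure rules
    apply. *)
Lemma nderivableS n f g :
  (forall x : R, is_derive x (1 : R) f (g x)) -> nderivable n g ->
  nderivable n.+1 f.
Proof. by move=> fg Cg; split=> [x|]; rewrite ?(derive1_funE _ _ fg). Qed.

Lemma nderivable_derive n f (x : R) :
  nderivable n.+1 f -> is_derive x 1 f (derive1 f x).
Proof. by case=> df _; rewrite derive1E; apply: derivableP. Qed.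

Lemma nderivable_pred n f : nderivable n.+1 f -> nderivable n f.
Proof. by elim: n f => // n IH f [df /IH]. Qed.

(** Bridge to the iterated [derive1n] in which [test_function] is phrased. *)
Lemma nderivable_derive1n n m f (x : R) :
  nderivable (n + m.+1) f -> derivable (derive1n n f) x 1.
Proof.
elim: n f => [f [+ _]|n IH f [_ /IH]]; first exact.
by rewrite /derive1n iterSr.
Qed.

Lemma nderivable_cst n (a : R) : nderivable n (cst a).
Proof.
by elim: n a => // n IH a; apply: (@nderivableS _ _ (cst 0)).
Qed.

Lemma nderivable_id n : nderivable n (@id R).
Proof.
case: n => // n; apply: (@nderivableS _ _ (cst 1)) => //.
exact: nderivable_cst.
Qed.

Lemma nderivableD n f g :
  nderivable n f -> nderivable n g -> nderivable n (f \+ g).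
Proof.
elim: n f g => // n IH f g Cf Cg.
apply: (@nderivableS _ _ (derive1 f \+ derive1 g)) => [x|]; last first.
  by apply: IH; [case: Cf | case: Cg].
have ? := nderivable_derive _ _ x Cf; have ? := nderivable_derive _ _ x Cg.
exact: is_deriveD.
Qed.

Lemma nderivableM n f g :
  nderivable n f -> nderivable n g -> nderivable n (f \* g).
Proof.
elim: n f g => // n IH f g Cf Cg.
apply: (@nderivableS _ _ ((f \* derive1 g) \+ (g \* derive1 f))) => [x|].
  have ? := nderivable_derive _ _ x Cf; have ? := nderivable_derive _ _ x Cg.
  exact: is_deriveM.
have [[_ Cf'] [_ Cg']] := (Cf, Cg).
by apply: nderivableD; apply: IH => //; exact: nderivable_pred.
Qed.

(** The chain rule leaves a product in which [g] reappears undifferentiated, so closure under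
    products comes first and [g] is lowered by one order. *)
Lemma nderivable_comp n f g :
  nderivable n f -> nderivable n g -> nderivable n (f \o g).
Proof.
elim: n f g => // n IH f g Cf Cg.
refine (@nderivableS _ _ ((derive1 f \o g) \* derive1 g) _ _) => [x|].
  have df := nderivable_derive _ _ (g x) Cf.
  have dg := nderivable_derive _ _ x Cg.
  exact: is_derive1_comp.
apply: nderivableM; last by case: Cg.
by apply: IH; [case: Cf | apply: nderivable_pred].
Qed.

(** Simultaneous induction, since each function is up to sign the derivative of the other. *)
Lemma nderivable_cos_sin n : nderivable n (@cos R) /\ nderivable n (@sin R).
Proof.
elim: n => [//|n [Cc Cs]]; split.
  apply: (@nderivableS _ _ (cst (-1) \* sin)); last first.
    by apply: nderivableM => //; apply: nderivable_cst.
  by move=> x; rewrite /= mulN1r; apply: is_derive_cos.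
by apply: (@nderivableS _ _ cos) => // x; apply: is_derive_sin.
Qed.

End smoothness.

(** * The flat function exp(-1/t) and its derivatives *)

Section cutoff.
Context {R : realType}.

(** The bound forces [f 0 = 0], and the difference quotient at 0 is then at most [M * |h|]. This
    serves to glue the two branches of [flat] at the origin. *)
Lemma is_derive0_quadratic (f : R -> R) (M : R) :
  (forall t, `|f t| <= M * t ^+ 2) -> is_derive (0 : R) (1 : R) f 0.
Proof.
move=> fM.
have f0 : f 0 = 0.
  by apply/eqP; rewrite -normr_le0 (le_trans (fM 0))// expr0n mulr0.
have M0 : 0 <= M by have := fM 1; rewrite expr1n mulr1; apply: le_trans.
have lim0 : (h^-1 *: (f (h *: 1 + 0) - f 0)) @[h --> (0 : R)^'] --> (0 : R).
  apply/cvgr0Pnorm_le => e e0; near=> h.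
  rewrite f0 subr0 addr0 /GRing.scale /= mulr1 normrM normfV.
  have h0 : 0 < `|h| by rewrite normr_gt0; near: h; exact: nbhs_dnbhs_neq.
  rewrite ler_pdivrMl//; apply: le_trans (fM h) _.
  rewrite -real_normK ?num_real// expr2 mulrA mulrC ler_wpM2l ?(ltW h0)//.
  (* The denominator is [M + 1] because [M] may be zero. *)
  have he : `|h| <= e / (M + 1).
    by near: h; apply: dnbhs0_le; rewrite divr_gt0// ltr_wpDl.
  apply: (@le_trans _ _ (M * (e / (M + 1)))); first exact: ler_wpM2l.
  rewrite mulrCA ler_piMr ?(ltW e0)// ler_pdivrMr ?ltr_wpDl// mul1r.
  by rewrite lerDl.
split; last exact: cvg_lim.
by apply/cvg_ex; exists 0.
Unshelve. all: by end_near. Qed.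

(* The powers of 1/t make the family closed under differentiation. *)
Definition flat k (t : R) : R :=
  if 0 < t then t^-1 ^+ k * expR (- t^-1) else 0.

Lemma flat_ge0 k t : 0 <= flat k t.
Proof.
rewrite /flat; case: ifPn => // t0.
by rewrite mulr_ge0 ?expR_ge0// exprn_ge0// invr_ge0 ltW.
Qed.

(** The term of degree [n + k + 1] in the series of exp(1/t) outweighs [t^-1 ^+ k] and leaves
    [n + 1] powers of t. The case [n = 1] gives the quadratic bound at 0, and [n = 0], [k = 2]
    bounds the derivative of the bump. *)
Lemma flat_le k n t : flat k t <= ((n + k).+1`!)%:R * `|t| ^+ n.+1.
Proof.
rewrite /flat; case: ifPn => [t0|_]; last by rewrite mulr_ge0// exprn_ge0.
have s0 : 0 < t^-1 by rewrite invr_gt0.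
have F0 : 0 < ((n + k).+1`!)%:R :> R by rewrite ltr0n fact_gt0.
have le_exp : t^-1 ^+ (n + k).+1 / ((n + k).+1`!)%:R <= expR t^-1.
  by apply: le_trans (expR_ge1Dxn (n + k) (ltW s0)); rewrite lerDr.
rewrite gtr0_norm// expRN ler_pdivrMr ?expR_gt0//.
apply: le_trans (_ : _ <= ((n + k).+1`!)%:R * t ^+ n.+1 *
  (t^-1 ^+ (n + k).+1 / ((n + k).+1`!)%:R)) _; last first.
  by rewrite ler_wpM2l// mulr_ge0 ?exprn_ge0 ?ltW.
rewrite -addSn exprD [t^-1 ^+ n.+1]exprVn.
have tn0 : t ^+ n.+1 != 0 by rewrite gt_eqF ?exprn_gt0.
move: (t ^+ n.+1) tn0 (t^-1 ^+ k) => T T0 a.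
by rewrite le_eqVlt; apply/orP; left; apply/eqP; field; rewrite T0 gt_eqF.
Qed.

(** The product rule settles positive t, the function is locally zero for negative t, and at 0 the
    quadratic bound yields derivative 0. *)
Lemma is_derive_flat k t :
  is_derive t (1 : R) (flat k) (flat k.+2 t - k%:R * flat k.+1 t).
Proof.
have [t0|t0|<-] := ltgtP 0 t.
- have tn0 : t != 0 by rewrite gt_eqF.
  have dV : is_derive t (1 : R) (fun s : R => s^-1) (- t ^- 2).
    by rewrite -[- _]mulr1; exact: is_deriveV.
  have dE : is_derive t (1 : R) (expR \o (fun s : R => - s^-1))%FUN
      (expR (- t^-1) * t ^- 2).
    rewrite -[X in _ * X]opprK; apply: is_derive1_comp.
  have d := is_deriveM (is_deriveX k dV) dE.
  apply: (near_eq_is_derive _ (@is_derive_eq _ _ _ _ _ _ _ _ d _)).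
    near=> s; rewrite exprfctE /flat ifT//; near: s; exact: lt_nbhsr.
  rewrite exprfctE /flat t0 /GRing.scale /= -!exprVn.
  by case: k {d} => [|k] /=; rewrite ?exprS ?expr0; ring.
- apply: (@near_eq_is_derive _ _ _ (cst (0 : R))).
    near=> s; rewrite /flat ifF//; apply/negbTE; rewrite -leNgt ltW//.
    by near: s; exact: lt_nbhsl.
  by apply: is_derive_eq; rewrite /flat ltNge (ltW t0) mulr0 subr0.
- rewrite {2 3}/flat ltxx mulr0 subr0.
  apply: (@is_derive0_quadratic _ (k.+2)`!%:R) => s.
  rewrite ger0_norm ?flat_ge0// -[s ^+ 2]real_normK ?num_real//.
  exact: (flat_le k 1).
Unshelve. all: by end_near. Qed.

Lemma nderivable_flat n k : nderivable n (flat k).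
Proof.
elim: n k => // n IH k.
apply: (@nderivableS _ _ _ (flat k.+2 \+ (cst (- k%:R) \* flat k.+1))) => [t|].
  by rewrite /= mulNr; exact: is_derive_flat.
by apply: nderivableD => //; apply: nderivableM => //; exact: nderivable_cst.
Qed.

End cutoff.

(** * A smooth bump supported in [-1, 1] *)

Section bump.
Context {R : realType}.

(** The standard bump exp(1 - 1/(1 - x^2)) on (-1, 1), extended by zero; the factor [expR 1]
    normalises its maximum, taken at 0, to 1. *)
Definition bump (x : R) : R := expR 1 * flat 0 (1 - x ^+ 2).

Lemma bump_ge0 x : 0 <= bump x.
Proof. by rewrite mulr_ge0 ?expR_ge0 ?flat_ge0. Qed.

Lemma bump_le1 x : bump x <= 1.
Proof.
rewrite /bump /flat; case: ifPn => [x1|_]; last by rewrite mulr0.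
rewrite expr0 mul1r -expRD -[leRHS]expR0 ler_expR subr_le0 invf_ge1//.
by rewrite gerBl sqr_ge0.
Qed.

Lemma bump0 : bump 0 = 1.
Proof.
rewrite /bump /flat expr0n subr0 ltr01 expr0 mul1r -expRD invr1 subrr.
exact: expR0.
Qed.

Lemma bump_out x : 1 <= `|x| -> bump x = 0.
Proof.
move=> x1; rewrite /bump /flat ifF ?mulr0//; apply/negbTE.
by rewrite subr_gt0 -real_normK ?num_real// -leNgt exprn_ege1.
Qed.

Lemma is_derive_bump (x : R) :
  is_derive x (1 : R) bump (expR 1 * (flat 2 (1 - x ^+ 2) * (- (2 * x)))).
Proof.
have dg : is_derive x (1 : R) (fun x : R => 1 - x ^+ 2) (- (2 * x)).
  apply: is_derive_eq; rewrite /GRing.scale /=; ring.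
have df := is_derive_flat 0 (1 - x ^+ 2).
rewrite mul0r subr0 in df.
have := @is_derive1_comp _ (flat 0) (fun x : R => 1 - x ^+ 2) _ _ _ df dg.
exact: is_deriveZ.
Qed.

Lemma nderivable_bump n : nderivable n bump.
Proof.
apply: (@nderivableM _ n (cst (expR 1)) (flat 0 \o (fun x => 1 - x ^+ 2))).
  exact: nderivable_cst.
apply: nderivable_comp; first exact: nderivable_flat.
rewrite (_ : (fun x => _) = cst 1 \+ (cst (-1) \* (id \* id))); last first.
  by apply/funext => x /=; rewrite mulN1r.
apply: nderivableD; first exact: nderivable_cst.
apply: nderivableM; first exact: nderivable_cst.
by apply: nderivableM; exact: nderivable_id.
Qed.

(** On [-1, 1] the factor [flat 2 (1 - x ^+ 2)] is at most 3! = 6 and [2 * x] at most 2 in modulus;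
    outside, the derivative vanishes. *)
Lemma derive1_bump_le x : `|derive1 bump x| <= 12 * expR 1.
Proof.
rewrite (derive1_funE _ _ is_derive_bump) normrM gtr0_norm ?expR_gt0//.
rewrite mulrC ler_wpM2r ?expR_ge0// normrM normrN normrM ger0_norm ?flat_ge0//.
rewrite [`|2|]ger0_norm//.
have [x1|x1] := leP `|x| 1; last first.
  rewrite /flat ifF ?mul0r//; apply/negbTE.
  by rewrite subr_gt0 -real_normK ?num_real// -leNgt exprn_ege1// ltW.
have x2 : `|1 - x ^+ 2| <= 1.
  rewrite ger0_norm ?gerBl ?sqr_ge0//.
  by rewrite subr_ge0 -real_normK ?num_real// expr_le1.
have := flat_le 2 0 (1 - x ^+ 2); rewrite expr1 => f2.
have f6 : flat 2 (1 - x ^+ 2) <= 6.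
  by apply: le_trans f2 _; rewrite -[leRHS]mulr1; exact: ler_wpM2l.
rewrite (_ : 12 = 6 * (2 * 1)); last by ring.
by apply: ler_pM => //; rewrite ?flat_ge0 ?mulr_ge0 ?ler_wpM2l.
Qed.

End bump.

(** * Testing a weak derivative against bounded smooth functions *)

Section weak_derivative_bounded.
Context {R : realType}.
Let mu := @lebesgue_measure R.

Lemma nderivable_continuous (f : R -> R) : nderivable 1 f -> continuous f.
Proof.
by case=> df _ x; apply: differentiable_continuous; exact/derivable1_diffP.
Qed.

Lemma integrableM_bounded (u g : R -> R) (B : R) :
  mu.-integrable setT (EFin \o u) -> measurable_fun setT g ->
  (forall x, `|g x| <= B) -> mu.-integrable setT (EFin \o (fun x => u x * g x)).
Proof.
move=> iu mg gB.
have /measurable_EFinP mu_ := measurable_int _ iu.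
apply: (le_integrable _ _ _ (integrableZl _ B iu)) => //.
  exact/measurable_EFinP/measurable_funM.
move=> x _; rewrite /= lee_fin !normrM mulrC ler_wpM2r//.
by rewrite (le_trans (gB x))// ler_norm.
Qed.

(** Cutting [K] off gives test functions still bounded by [M], and dominated convergence removes the
    cutoff; [B] serves for the domination. *)
Lemma Rintegral_weak_derivative_le (u v K : R -> R) (M B : R) :
  mu.-integrable setT (EFin \o u) -> mu.-integrable setT (EFin \o v) ->
  (forall phi, test_function phi ->
    \int[mu]_x (u x * derive1 phi x) = - \int[mu]_x (v x * phi x)) ->
  (forall n, nderivable n K) -> (forall x, `|K x| <= M) ->
  (forall x, `|derive1 K x| <= B) ->
  `|\int[mu]_x (u x * derive1 K x)| <= M * \int[mu]_x `|v x|.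
Proof.
move=> iu iv uv CK KM KB.
(* Since [harmonic n] is 1/(n + 1), the cutoff lives on [-(n + 1), n + 1] and tends pointwise to
   [bump 0 = 1]. *)
pose phi n x := bump (harmonic n * x) * K x.
pose dphi n x := bump (harmonic n * x) * derive1 K x +
  K x * (derive1 bump (harmonic n * x) * harmonic n).
have Cphi n k : nderivable k (phi n).
  apply: (@nderivableM _ k (bump \o (cst (harmonic n) \* id)) K) => //.
  apply: nderivable_comp; first exact: nderivable_bump.
  by apply: nderivableM; [exact: nderivable_cst | exact: nderivable_id].
have tphi n : test_function (phi n).
  split=> [k x|]; first exact: (@nderivable_derive1n _ k 0).
  have sub : [set x | phi n x != 0] `<=` `[- n.+1%:R, n.+1%:R].
    move=> x /=; apply: contraNT; rewrite in_itv /= -ler_norml -ltNge => nx.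
    rewrite /phi bump_out ?mul0r//= normrM gtr0_norm//.
    by rewrite ler_pdivlMl// mulr1 ltW.
  apply: (subclosed_compact (@closed_closure _ _)
    (@segment_compact _ (- n.+1%:R) n.+1%:R)).
  rewrite [X in _ `<=` X](closure_id _).1; last exact: itv_closed.
  exact: closureS.
have dphiE n : derive1 (phi n) = dphi n.
  apply: derive1_funE => x.
  have dK := nderivable_derive _ _ x (CK 1%N).
  have db := nderivable_derive _ _ (harmonic n * x) (nderivable_bump 1).
  have dl : is_derive x (1 : R) (fun x => harmonic n * x) (harmonic n).
    by apply: is_derive_eq; rewrite /GRing.scale /= mulr1.
  have dc := @is_derive1_comp _ bump (fun x => harmonic n * x) _ _ _ db dl.
  exact: is_deriveM.
have phi_le n x : `|phi n x| <= M.
  rewrite normrM -[M]mul1r ler_pM// ger0_norm ?bump_ge0//; exact: bump_le1.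
have mphi n : measurable_fun setT (phi n).
  by apply: continuous_measurable_fun; apply: nderivable_continuous.
have lim : \int[mu]_x (u x * dphi n x) @[n --> \oo] -->
    \int[mu]_x (u x * derive1 K x).
  (* The constant adds [B], for the term with [derive1 K], to a bound for the term with
     [derive1 bump], where [harmonic n <= 1]. *)
  have ig : mu.-integrable setT
      (fun x => ((B + `|M| * (12 * expR 1)) * `|u x|)%:E).
    exact: (integrableZl measurableT _ (integrable_norm iu)).
  have mu_ : measurable_fun setT u.
    by apply/measurable_EFinP; exact: measurable_int iu.
  have mdK : measurable_fun setT (derive1 K).
    apply: continuous_measurable_fun; apply: nderivable_continuous.
    by case: (CK 2%N).
  have mdphi n : measurable_fun setT (dphi n).
    rewrite -dphiE; apply: continuous_measurable_fun.
    apply: nderivable_continuous.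
    by case: (Cphi n 2%N).
  have lim0 x : harmonic n * x @[n --> \oo] --> (0 : R).
    by rewrite -[0](mul0r x); apply: cvgMl; exact: cvg_harmonic.
  have lim_dphi x : dphi n x @[n --> \oo] --> derive1 K x.
    rewrite -[derive1 K x]addr0 -[derive1 K x in X in _ --> X]mul1r.
    apply: cvgD.
      apply: cvgMl; rewrite -bump0; apply: continuous_cvg; last exact: lim0.
      apply: nderivable_continuous _ (nderivable_bump 1) _.
    (* Differentiating the dilated cutoff brings out a factor [harmonic n], so this term vanishes in
       the limit. *)
    apply: norm_cvg0; apply: (@squeeze_cvgr _ _ _ _ (cst 0)
      (fun n => M * (12 * expR 1) * harmonic n)).
    - near=> n; rewrite normr_ge0/= !normrM.
      have h0 := ltW (@harmonic_gt0 R n).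
      rewrite (ger0_norm h0) -[leRHS]mulrA; apply: ler_pM => //.
        by rewrite mulr_ge0.
      by rewrite ler_wpM2r// derive1_bump_le.
    - exact: cvg_cst.
    - rewrite -(mulr0 (M * (12 * expR 1))); apply: cvgMr; exact: cvg_harmonic.
  have [] := @dominated_convergence _ _ _ mu setT measurableT
     (fun n => EFin \o (fun x => u x * dphi n x))
     (EFin \o (fun x => u x * derive1 K x))
     (fun x => ((B + `|M| * (12 * expR 1)) * `|u x|)%:E).
  - move=> n; apply/measurable_EFinP.
    exact: (measurable_funM mu_ (mdphi n)).
  - by apply/measurable_EFinP; exact: (measurable_funM mu_ mdK).
  - apply: aeW => x _; apply: cvg_EFin; first exact: nearW.
    by apply: cvgMr; exact: lim_dphi.
  - exact: ig.
  - apply: aeW => x n _; rewrite lee_fin normrM mulrC ler_wpM2r//.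
    apply: le_trans (ler_normD _ _) _; apply: lerD.
      rewrite normrM -[B]mul1r ler_pM// ger0_norm ?bump_ge0//; exact: bump_le1.
    rewrite normrM ler_pM//; first exact: le_trans (KM x) (ler_norm _).
    rewrite normrM -[leRHS]mulr1 ler_pM// ?derive1_bump_le//.
    by rewrite (ger0_norm (ltW (harmonic_gt0 n)))/= invf_le1// ler1n.
  move=> ilim _ cv; apply: fine_cvg; apply: cvg_trans cv _.
  by rewrite /Rintegral fineK//; exact: integrable_fin_num ilim.
(* The bound holds for each [phi n], by the weak derivative identity, and passes to the limit. *)
apply: (ler_cvg_to (cvg_norm lim) (cvg_cst _)); near=> n.
rewrite -dphiE uv// normrN.
apply: le_trans (le_normr_Rintegral _ _) _ => //.
  exact: integrableM_bounded iv (mphi n) (phi_le n).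
rewrite -RintegralZl//; last exact: integrable_norm.
apply: le_Rintegral => //.
- by apply: integrable_norm; exact: integrableM_bounded iv (mphi n) (phi_le n).
- exact: (integrableZl measurableT _ (integrable_norm iv)).
- by move=> x _; rewrite normrM mulrC ler_wpM2r.
Unshelve. all: by end_near. Qed.

End weak_derivative_bounded.

(** * Antiderivatives on the whole line and comparison of increments *)

Section antiderivative.
Context {R : realType}.
Let mu := @lebesgue_measure R.

(** Primitives based at [- N] and normalised at 0 agree wherever they overlap, so the base point may
    move with x to cover the line. *)
Lemma ex_antiderivative (g : R -> R) : continuous g ->
  exists2 G : R -> R, G 0 = 0 & forall x : R, is_derive x (1 : R) G (g x).
Proof.
move=> cg.
have ig a b : mu.-integrable `[a, b] (EFin \o g).
  apply: continuous_compact_integrable; first exact: segment_compact.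
  exact: continuous_subspaceT.
pose F N x := \int[mu]_(t in `[- N, x]) g t - \int[mu]_(t in `[- N, 0]) g t.
have FE N M x : 0 <= N -> - N <= x -> N <= M -> F N x = F M x.
  move=> N0 Nx NM.
  have split y : - N <= y -> \int[mu]_(t in `[- M, y]) g t =
      \int[mu]_(t in `[- M, - N]) g t + \int[mu]_(t in `[- N, y]) g t.
    move=> Ny; apply/eqP; rewrite addrC -subr_eq; apply/eqP.
    rewrite Rintegral_itvB ?bnd_simp//; last by rewrite lerN2.
    rewrite Rintegral_itv_obnd_cbnd//.
    by apply: integrableS (ig (- N) y) => //; exact: subset_itv_oc_cc.
  rewrite /F (split x)// (split 0) ?oppr_le0//; ring.
(* The base point [- (|x| + 1)] lies to the left of both x and 0. *)
pose G x := F (`|x| + 1) x.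
exists G => [|x]; first by rewrite /G /F subrr.
(* Every y within 1 of x satisfies [|y| + 1 <= N], so [G] coincides with the single primitive [F N]
   near x. *)
pose N := `|x| + 2.
have N0 : 0 <= N by rewrite addr_ge0.
have xN : - N < x.
  by rewrite ltrNl (le_lt_trans (ler_norm _))// normrN ltrDl.
apply: (@near_eq_is_derive _ _ _ (F N)).
  near=> y; have yN : `|y| + 1 <= N.
    rewrite /N (_ : 2 = 1 + 1)// addrA lerD2r.
    have -> : y = x + (y - x) by rewrite addrC subrK.
    rewrite (le_trans (ler_normD _ _))// lerD2l distrC.
    by near: y; exact: (@cvgr_dist_le _ _ _ _ _ id x cvg_id 1 ltr01).
  rewrite /G (FE (`|y| + 1) N)// ?addr_ge0//.
  rewrite lerNl (le_trans (ler_norm _))// normrN lerDl//.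
(* The right end [x + 1] only has to put x in the interior of the interval. *)
have [dF F'] := @continuous_FTC1_closed _ g (- N) x (x + 1)
  ltac:(by rewrite ltrDl) (ig _ _) xN (cg x).
rewrite -[g x]subr0; apply: is_deriveB.
rewrite -F' derive1E; exact: derivableP.
Unshelve. all: by end_near. Qed.

(** By the mean value theorem neither [h - f] nor [h + f] decreases from [a] to [b]. *)
Lemma ler_dist_derive (f h df dh : R -> R) (a b : R) : a <= b ->
  (forall x, a <= x -> is_derive x (1 : R) f (df x)) ->
  (forall x, a <= x -> is_derive x (1 : R) h (dh x)) ->
  (forall x, a <= x -> `|df x| <= dh x) ->
  `|f b - f a| <= h b - h a.
Proof.
move=> ab Df Dh dfh.
have nondecr (k dk : R -> R) :
    (forall x, a <= x -> is_derive x (1 : R) k (dk x)) ->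
    (forall x, a <= x -> 0 <= dk x) -> 0 <= k b - k a.
  move=> Dk dk0; have [//|x xab||x xab ->] := @MVT_segment _ k dk a b.
  - by apply: Dk; rewrite (itvP xab).
  - apply: derivable_within_continuous => x xab.
    by have [] := Dk x; rewrite ?(itvP xab).
  - by rewrite mulr_ge0 ?subr_ge0 ?dk0 ?(itvP xab).
have := nondecr (h - f) (fun x => dh x - df x).
have := nondecr (h + f) (fun x => dh x + df x).
rewrite !fctE => hD hB; rewrite ler_norml; apply/andP; split.
  have : 0 <= h b + f b - (h a + f a); last by lra.
  apply: hD => x ax; first by apply: is_deriveD; [apply: Dh | apply: Df].
  by have := dfh x ax; rewrite ler_norml => /andP[]; lra.
have : 0 <= h b - f b - (h a - f a); last by lra.
apply: hB => x ax; first by apply: is_deriveB; [apply: Dh | apply: Df].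
by have := dfh x ax; rewrite ler_norml => /andP[]; lra.
Qed.

End antiderivative.

(** * First-derivative estimates for the oscillatory primitive *)

Section oscillatory.
Context {R : realType}.

(* First-derivative test: past 1/sqrt c, K differs from q(c x^2)/(2 c x) by a
   function whose derivative is at most 1/(2 c x^2); before it, |K'| <= 1. *)
Lemma oscillatory_le_pos (p q K : R -> R) (c x : R) : 0 < c -> 0 <= x ->
  (forall y : R, is_derive y (1 : R) q (p y)) ->
  (forall y, `|p y| <= 1) -> (forall y, `|q y| <= 1) -> K 0 = 0 ->
  (forall y : R, is_derive y (1 : R) K (p (c * y ^+ 2))) ->
  `|K x| <= 2 / Num.sqrt c.
Proof.
move=> c0 x0 Dq p1 q1 K0 DK.
(* At this point the trivial bound y and the oscillatory bound 1/(c y) balance. *)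
set a := (Num.sqrt c)^-1.
have a0 : 0 < a by rewrite invr_gt0 sqrtr_gt0.
have ca : c * a = a^-1.
  by rewrite /a invrK -{1}(sqr_sqrtr (ltW c0)) expr2 mulfK// gt_eqF ?sqrtr_gt0.
have K_le y : 0 <= y -> `|K y| <= y.
  move=> y0; have := @ler_dist_derive _ K id _ (cst 1) 0 y y0 (fun x _ => DK x).
  by rewrite K0 !subr0; apply => // z _; apply: is_derive_id.
have [xa|ax] := leP x a.
  rewrite (le_trans (K_le _ x0))// (le_trans xa)//.
  by rewrite mulr_natl mulr2n lerDl ltW.
have Dw y : a <= y -> is_derive y (1 : R)
    (fun y => (2 * c * y)^-1) (- (2 * c * y ^+ 2)^-1).
  move=> ay; have y0 : y != 0 by rewrite gt_eqF// (lt_le_trans a0).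
  apply: is_derive_eq.
    apply: is_deriveV; first by rewrite !mulf_neq0// gt_eqF.
  rewrite /GRing.scale /=; field; rewrite y0 gt_eqF//.
have Dqc y : is_derive y (1 : R) (fun y => q (c * y ^+ 2))
    (p (c * y ^+ 2) * (2 * c * y)).
  have dg : is_derive y (1 : R) (fun y : R => c * y ^+ 2) (2 * c * y).
    apply: is_derive_eq; rewrite /GRing.scale /=; ring.
  exact: (@is_derive1_comp _ q (fun y => c * y ^+ 2) _ _ _ (Dq _) dg).
pose w y := (2 * c * y)^-1.
pose f y := K y - q (c * y ^+ 2) * w y.
have main : `|f x - f a| <= - w x - - w a.
  apply: (@ler_dist_derive _ f (fun y => - w y)
      (fun y => q (c * y ^+ 2) * (2 * c * y ^+ 2)^-1)
      (fun y => (2 * c * y ^+ 2)^-1) a x (ltW ax)) => y ay.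
  - have y0 : y != 0 by rewrite gt_eqF// (lt_le_trans a0).
    have d := is_deriveB (DK y) (is_deriveM (Dqc y) (Dw y ay)).
    apply: (@is_derive_eq _ _ _ _ _ _ _ _ d _).
    rewrite /GRing.scale /=; field; rewrite y0 gt_eqF//.
  - by rewrite -[X in is_derive _ _ _ X]opprK; apply: is_deriveN; exact: Dw.
  - rewrite normrM -[leRHS]mul1r.
    have n0 : 0 <= (2 * c * y ^+ 2)^-1.
      by rewrite invr_ge0 mulr_ge0 ?sqr_ge0// mulr_ge0 ?ltW.
    by rewrite (ger0_norm n0) ler_wpM2r.
have wx0 : 0 <= w x by rewrite invr_ge0 !mulr_ge0// ltW.
have wa : w a = a / 2 by rewrite /w -mulrA ca invfM invrK mulrC.
have qw y : 0 <= w y -> `|q (c * y ^+ 2) * w y| <= w y.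
  by move=> wy; rewrite normrM (ger0_norm wy) -[leRHS]mul1r ler_wpM2r.
have qx := qw x wx0; have qa := qw a ltac:(by rewrite wa divr_ge0 ?ltW).
have Ka := K_le a (ltW a0).
(* The drift of [f] is at most [a / 2 - w x], the boundary terms at x and [a] at most [w x] and
   [a / 2], and [K a] at most [a]; the sum is [2 * a]. *)
move: main qx qa Ka; rewrite /f wa !ler_norml.
move=> /andP[? ?] /andP[? ?] /andP[? ?] /andP[? ?].
by apply/andP; split; lra.
Qed.

(** As the phase is even, the reflection [- K (- y)] satisfies the same hypotheses, which reduces
    negative x to positive x. *)
Lemma oscillatory_le (p q K : R -> R) (c x : R) : 0 < c ->
  (forall y : R, is_derive y (1 : R) q (p y)) ->
  (forall y, `|p y| <= 1) -> (forall y, `|q y| <= 1) -> K 0 = 0 ->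
  (forall y : R, is_derive y (1 : R) K (p (c * y ^+ 2))) ->
  `|K x| <= 2 / Num.sqrt c.
Proof.
move=> c0 Dq p1 q1 K0 DK; have [x0|x0] := leP 0 x.
  exact: oscillatory_le_pos Dq p1 q1 K0 DK.
have x0' : 0 <= - x by rewrite oppr_ge0 ltW.
rewrite -[x]opprK -normrN.
apply: (@oscillatory_le_pos p q (fun y => - K (- y)) c (- x)) => //.
  by rewrite oppr0 K0 oppr0.
move=> y; have d : is_derive (- y) (1 : R) K (p (c * y ^+ 2)).
  by rewrite -sqrrN; exact: DK.
have dc := @is_derive1_comp _ K (fun y : R => - y) _ _ _ d (is_deriveNid _ _).
apply: (@is_derive_eq _ _ _ _ _ _ _ _ (is_deriveN dc) _).
by rewrite mulrN1 opprK.
Qed.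

End oscillatory.

(** * Real and imaginary parts, the modulus and the L1 norm *)

Section complex_valued.
Local Open Scope complex_scope.
Context {R : realType}.
Let mu := @lebesgue_measure R.
Implicit Types f : R -> R[i].

Lemma complex_ReM (x y : R[i]) :
  complex.Re (x * y) =
    complex.Re x * complex.Re y - complex.Im x * complex.Im y.
Proof. by case: x => a b; case: y. Qed.

Lemma complex_ImM (x y : R[i]) :
  complex.Im (x * y) =
    complex.Re x * complex.Im y + complex.Im x * complex.Re y.
Proof. by case: x => a b; case: y. Qed.

(** Cauchy-Schwarz in the plane, from the square of [|a| - |b|] being nonnegative. *)
Lemma ler_ReIm_cmod (z : R[i]) :
  `|complex.Re z| + `|complex.Im z| <= Num.sqrt 2 * cmod z.
Proof.
case: z => a b /=; rewrite -sqrtrM// -[leLHS]ger0_norm ?addr_ge0//.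
rewrite -sqrtr_sqr ler_sqrt ?mulr_ge0 ?addr_ge0 ?sqr_ge0//.
rewrite -(real_normK (num_real a)) -(real_normK (num_real b)).
by have := sqr_ge0 (`|a| - `|b|); lra.
Qed.

Lemma cmod_le (z : R[i]) (b : R) :
  `|complex.Re z| <= b -> `|complex.Im z| <= b -> cmod z <= Num.sqrt 2 * b.
Proof.
case: z => x y /= xb yb; have b0 : 0 <= b := le_trans (normr_ge0 _) xb.
rewrite -[X in _ <= _ * X](ger0_norm b0) -sqrtr_sqr -sqrtrM//.
rewrite ler_sqrt ?mulr_ge0 ?sqr_ge0//.
rewrite -(real_normK (num_real x)) -(real_normK (num_real y)).
by rewrite mulr_natl mulr2n lerD// lerXn2r// nnegrE.
Qed.

(** Test functions are real, so the complex identity splits into two real ones. *)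
Lemma weak_derivative_ReIm f f' : weak_derivative f f' ->
  forall phi, test_function phi ->
  \int[mu]_x (complex.Re (f x) * derive1 phi x) =
    - (\int[mu]_x (complex.Re (f' x) * phi x)) /\
  \int[mu]_x (complex.Im (f x) * derive1 phi x) =
    - \int[mu]_x (complex.Im (f' x) * phi x).
Proof.
move=> [_ _ wd] phi /wd.
have ReE (h : R -> R[i]) (r : R -> R) :
    (fun x => complex.Re (h x * (r x)%:C)) = (fun x => complex.Re (h x) * r x).
  by apply/funext => x; rewrite complex_ReM /= mulr0 subr0.
have ImE (h : R -> R[i]) (r : R -> R) :
    (fun x => complex.Im (h x * (r x)%:C)) = (fun x => complex.Im (h x) * r x).
  by apply/funext => x; rewrite complex_ImM /= mulr0 add0r.
by rewrite /Cintegral !ReE !ImE; case.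
Qed.

Lemma L1_normE f : L1_norm f = (\int[mu]_x (cmod (f x))%:E)%E.
Proof.
rewrite /L1_norm Lnorm1; apply: eq_integral => x _ /=.
by case: (f x) => a b /=; rewrite ger0_norm ?sqrtr_ge0.
Qed.

(** Local integrability supplies measurability, and the modulus dominates both parts. *)
Lemma L1_norm_integrable f : L1_loc f -> (L1_norm f < +oo)%E ->
  mu.-integrable setT (EFin \o (fun x => cmod (f x))) /\ L1_integrable f.
Proof.
move=> [[mre _ _] [mim _ _]] foo.
have cmodE x : cmod (f x) =
    Num.sqrt (complex.Re (f x) ^+ 2 + complex.Im (f x) ^+ 2).
  by case: (f x).
have mcmod : measurable_fun setT (fun x => cmod (f x)).
  under eq_fun do rewrite cmodE.
  apply: measurableT_comp.
    by apply: continuous_measurable_fun; exact: sqrt_continuous.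
  by apply: measurable_funD; exact: measurable_funX.
have cmod0 x : 0 <= cmod (f x) by rewrite cmodE sqrtr_ge0.
have icmod : mu.-integrable setT (EFin \o (fun x => cmod (f x))).
  apply/integrableP; split; first exact/measurable_EFinP.
  move: foo; rewrite L1_normE; congr (_ < _)%E.
  by apply: eq_integral => x _ /=; rewrite ger0_norm.
split=> //; split; apply: le_integrable icmod => //; try exact/measurable_EFinP.
- move=> x _; rewrite /= lee_fin (ger0_norm (cmod0 x)) cmodE.
  by rewrite -[leLHS]sqrtr_sqr ler_sqrt ?addr_ge0 ?sqr_ge0// lerDl sqr_ge0.
- move=> x _; rewrite /= lee_fin (ger0_norm (cmod0 x)) cmodE.
  by rewrite -[leLHS]sqrtr_sqr ler_sqrt ?addr_ge0 ?sqr_ge0// lerDr sqr_ge0.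
Qed.

End complex_valued.

(** * Estimate of the chirp transform *)

Section chirp.
Context {R : realType}.
Let mu := @lebesgue_measure R.

Lemma nderivable_comp_quadratic n (p : R -> R) (c : R) :
  nderivable n p -> nderivable n (fun x => p (c * x ^+ 2)).
Proof.
move=> Cp; apply: (@nderivable_comp _ n p (fun x => c * x ^+ 2)) => //.
apply: (@nderivableM _ n (cst c) (id \* id)); first exact: nderivable_cst.
by apply: nderivableM; exact: nderivable_id.
Qed.

(** The kernel is the derivative of its primitive [K] vanishing at 0, and [K] is bounded by
    [2 / Num.sqrt c]. *)
Lemma Rintegral_oscillatory_le (u v p q : R -> R) (c : R) : 0 < c ->
  mu.-integrable setT (EFin \o u) -> mu.-integrable setT (EFin \o v) ->
  (forall phi, test_function phi ->
    \int[mu]_x (u x * derive1 phi x) = - \int[mu]_x (v x * phi x)) ->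
  (forall n, nderivable n p) -> (forall y : R, is_derive y (1 : R) q (p y)) ->
  (forall y, `|p y| <= 1) -> (forall y, `|q y| <= 1) ->
  `|\int[mu]_x (u x * p (c * x ^+ 2))| <=
  2 / Num.sqrt c * \int[mu]_x `|v x|.
Proof.
move=> c0 iu iv uv Cp Dq p1 q1.
have Cg n := nderivable_comp_quadratic n _ c (Cp n).
have [K K0 DK] := ex_antiderivative _ (nderivable_continuous _ (Cg 1%N)).
have K'E := derive1_funE _ _ DK.
have := @Rintegral_weak_derivative_le _ u v K (2 / Num.sqrt c) 1 iu iv uv.
rewrite K'E; apply => // [n|x].
  by apply: nderivable_pred; exact: nderivableS DK (Cg n).
exact: oscillatory_le c0 Dq p1 q1 K0 DK.
Qed.

(** Each part of the transform is at most [M * (A + B)]. Recombining them costs a factor sqrt 2, and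
    bounding [A + B] by the norm of [f'] another, whence [2 * M = 4 / Num.sqrt c]. *)
Lemma cmod_chirp_le (f f' : R -> R[i]) (lambda : R) : 0 < lambda ->
  L1_integrable f -> L1_integrable f' ->
  mu.-integrable setT (EFin \o (fun x => cmod (f' x))) ->
  weak_derivative f f' ->
  cmod (chirp f lambda) <=
  4 / Num.sqrt (pi * lambda) * \int[mu]_x cmod (f' x).
Proof.
move=> l0 [iu iv] [iu' iv'] icmod wd.
have c0 : 0 < pi * lambda by rewrite mulr_gt0 ?pi_gt0.
set c := pi * lambda in c0 *; pose M := 2 / Num.sqrt c.
have M0 : 0 <= M by rewrite divr_ge0 ?sqrtr_ge0.
have [Cc Cs] :
    (forall n, nderivable n (@cos R)) /\ (forall n, nderivable n (@sin R)).
  by split=> n; have [] := @nderivable_cos_sin R n.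
have c1 (y : R) : `|cos y| <= 1 by rewrite ler_norml cos_geN1 cos_le1.
have s1 (y : R) : `|sin y| <= 1 by rewrite ler_norml sin_geN1 sin_le1.
have Nc1 (y : R) : `|- cos y| <= 1 by rewrite normrN.
have DNc (y : R) : is_derive y (1 : R) (fun y => - cos y) (sin y).
  by rewrite -[sin y]opprK; apply: is_deriveN.
have wdR phi tphi := (weak_derivative_ReIm _ _ wd phi tphi).1.
have wdI phi tphi := (weak_derivative_ReIm _ _ wd phi tphi).2.
pose A := \int[mu]_x `|complex.Re (f' x)|.
pose B := \int[mu]_x `|complex.Im (f' x)|.
(* Both parts of [f] meet both kernels: the pair [p], [q] is [cos], [sin] and then [sin],
   [- cos]. *)
have Rc := Rintegral_oscillatory_le _ _ _ _ _ c0 iu iu' wdR Cc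
  (@is_derive_sin R) c1 s1.
have Rs := Rintegral_oscillatory_le _ _ _ _ _ c0 iu iu' wdR Cs DNc s1 Nc1.
have Ic := Rintegral_oscillatory_le _ _ _ _ _ c0 iv iv' wdI Cc
  (@is_derive_sin R) c1 s1.
have Is := Rintegral_oscillatory_le _ _ _ _ _ c0 iv iv' wdI Cs DNc s1 Nc1.
have mq (p : R -> R) : (forall n, nderivable n p) ->
    measurable_fun setT (fun x : R => p (c * x ^+ 2)).
  move=> Cp; apply: continuous_measurable_fun; apply: nderivable_continuous.
  exact: nderivable_comp_quadratic.
have iM (u p : R -> R) : mu.-integrable setT (EFin \o u) ->
    (forall n, nderivable n p) -> (forall y, `|p y| <= 1) ->
    mu.-integrable setT (EFin \o (fun x => u x * p (c * x ^+ 2))).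
  by move=> hu Cp p1; apply: integrableM_bounded hu (mq _ Cp) (fun=> p1 _).
have AB : A + B <= Num.sqrt 2 * \int[mu]_x cmod (f' x).
  rewrite -RintegralD//; [|exact: integrable_norm iu'
                         |exact: integrable_norm iv'].
  rewrite -RintegralZl//; apply: le_Rintegral => //.
  - apply: (integrableD _ (integrable_norm iu') (integrable_norm iv')) => //.
  - exact: (integrableZl measurableT _ icmod).
  - by move=> x _; exact: ler_ReIm_cmod.
have chirp_le : cmod (chirp f lambda) <= Num.sqrt 2 * (M * (A + B)).
  apply: cmod_le; rewrite /chirp /Cintegral /=.
  - have -> : (fun x => complex.Re (f x * expi (- (c * x ^+ 2)))) =
        (fun x => complex.Re (f x) * cos (c * x ^+ 2) +
                  complex.Im (f x) * sin (c * x ^+ 2)).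
      by apply/funext => x; rewrite complex_ReM /= cosN sinN mulrN opprK.
    rewrite RintegralD ?iM//.
    by rewrite mulrDr (le_trans (ler_normD _ _))// lerD.
  - have -> : (fun x => complex.Im (f x * expi (- (c * x ^+ 2)))) =
        (fun x => complex.Im (f x) * cos (c * x ^+ 2) -
                  complex.Re (f x) * sin (c * x ^+ 2)).
      by apply/funext => x; rewrite complex_ImM /= cosN sinN mulrN addrC.
    rewrite RintegralB ?iM//.
    by rewrite mulrDr (le_trans (ler_normB _ _))// addrC lerD.
apply: le_trans chirp_le _.
apply: le_trans
  (_ : _ <= Num.sqrt 2 * (M * (Num.sqrt 2 * \int[mu]_x cmod (f' x)))) _.
  by rewrite !ler_wpM2l ?sqrtr_ge0.
have s2 : Num.sqrt 2 * Num.sqrt 2 = 2 :> R by rewrite -expr2 sqr_sqrtr.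
rewrite (_ : 4 / Num.sqrt c = Num.sqrt 2 * Num.sqrt 2 * M); last first.
  by rewrite s2 /M; ring.
by rewrite le_eqVlt; apply/orP; left; apply/eqP; ring.
Qed.

End chirp.

Theorem proposition1 (R : realType) (f f' : R -> R[i])
    (hf : W011 f) (hf' : weak_derivative f f')
    (lambda : R) (hlambda : 0 < lambda) :
  ((cmod (chirp f lambda))%:E <=
    (2 * Num.sqrt 6 / Num.sqrt pi)%:E * L1_norm f' *
    (lambda `^ (- 2^-1))%:E)%E.
Proof.
have C0 : 0 < 2 * Num.sqrt 6 / Num.sqrt pi :> R.
  by rewrite divr_gt0 ?mulr_gt0 ?sqrtr_gt0 ?pi_gt0.
(* An infinite norm makes the right-hand side [+oo], as the other two factors are positive. *)
have [foo|] := ltP (L1_norm f') +oo%E; last first.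
  rewrite leye_eq => /eqP ->.
  by rewrite gt0_muley ?lte_fin// gt0_mulye ?leey// lte_fin powR_gt0.
have [_ locf' _] := hf'; have [_ _ If _] := hf.
have [icmod If'] := L1_norm_integrable _ locf' foo.
have le := cmod_chirp_le _ _ _ hlambda If If' icmod hf'.
have LE : L1_norm f' = (\int[lebesgue_measure]_x cmod (f' x))%:E.
  by rewrite L1_normE /Rintegral fineK//; exact: integrable_fin_num icmod.
rewrite LE -!EFinM lee_fin; apply: le_trans le _.
have L0 : 0 <= \int[lebesgue_measure]_x cmod (f' x).
  by apply: Rintegral_ge0 => x _; case: (f' x) => a b; exact: sqrtr_ge0.
(* Cancelling the norm and the roots of [lambda] and [pi] leaves [4 <= 2 * Num.sqrt 6]. *)
rewrite powRN powR12_sqrt ?(ltW hlambda)// [leRHS]mulrAC ler_wpM2r//.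
rewrite sqrtrM ?pi_ge0// invfM mulrA ler_wpM2r ?invr_ge0 ?sqrtr_ge0//.
rewrite ler_wpM2r ?invr_ge0 ?sqrtr_ge0//.
rewrite (_ : 4 = 2 * 2); last by ring.
rewrite ler_wpM2l// -[X in X <= _]ger0_norm// -sqrtr_sqr ler_sqrt//.
by lra.
Qed.
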